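(* Let $\mathbb{X},\mathbb{Y}$ be Euclidean spaces, $\Phi:\mathbb{X}\to\mathbb{Y}$ a linear operator, $R:\mathbb{X}\to\mathbb{R}$ a continuous convex function, and $y_0\in\mathbb{Y}$. If $x_0$ is a sharp minimizer of the problem $\min_{x\in\mathbb{X}} R(x)$ subject to $\Phi x=y_0$, then $$\operatorname{Ker}\Phi\cap T_{\partial R^*(\operatorname{Im}\Phi^* )}(x_0)=\{0\},$$ i.e., stable recovery occurs at $x_0$.
   Context: Euclidean spaces are finite-dimensional real inner product spaces; $\|\cdot\|$ is the associated norm. $\Phi^*$ is the adjoint of $\Phi$. Sharp minimizer of the problem: $\Phi x_0=y_0$ and there are $c,\varepsilon>0$ with $\varphi(x)-\varphi(x_0)\ge c\|x-x_0\|$ for all $x$ with $\|x-x_0\|\le\varepsilon$, where $\varphi(x)=R(x)$ if $\Phi x=y_0$ and $\varphi(x)=\infty$ otherwise. Fenchel conjugate: $R^*(v)=\sup\{\langle v,x\rangle-R(x)\mid x\in\mathbb{X}\}$. $\partial$ is the convex subdifferential, so $x\in\partial R^*(v)$ if and only if $v\in\partial R(x)$. For a set $S$, $\partial R^*(S):=\bigcup_{v\in S}\partial R^*(v)$. Tangent (contingent) cone: for a closed set $\Omega\subset\mathbb{X}$ and $x_0\in\Omega$, $T_\Omega(x_0):=\{w\in\mathbb{X}\mid \exists\, t_k\downarrow 0,\ w_k\to w:\ x_0+t_kw_k\in\Omega\}$. Stable recovery: for $y\in\mathbb{Y}$ and $\mu>0$ let $P(y,\mu)$ be the problem $\min_{x\in\mathbb{X}}\frac12\|\Phi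 x-y\|^2+\mu R(x)$. Stable recovery occurs at $x_0$ if for every constant $c>0$ there exist $K>0$ and $\bar\delta>0$ such that for all $\delta\in(0,\bar\delta)$, all $y$ with $\|y-y_0\|\le\delta$, and $\mu=c\delta$, every optimal solution $x(y,\mu)$ of $P(y,\mu)$ satisfies $\|x(y,\mu)-x_0\|\le K\delta$. *)

(* Defs.v *)
From HB Require Import structures.
From mathcomp Require Import all_boot all_order all_algebra.
From mathcomp Require Import all_classical all_reals all_analysis.

Set Implicit Arguments.
Unset Strict Implicit.
Unset Printing Implicit Defensive.

Import Order.TTheory GRing.Theory Num.Theory.
Import numFieldNormedType.Exports.

Local Open Scope classical_set_scope.
Local Open Scope ring_scope.

(* The norm and the topology are those of the normed module; [dotp_normE]
   forces this norm to be the one induced by the inner product. *)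
HB.mixin Record NormedVector_isEuclidean (K : realType) X
    & NormedModule K X & Vector K X := {
  dotp : {dot X for @idfun K};
  dotp_normE : forall x : X, `|x| ^+ 2 = (dotp : X -> X -> K) x x
}.

#[short(type="euclideanType")]
HB.structure Definition Euclidean (K : realType) :=
  {X of NormedModule K X & Vector K X & NormedVector_isEuclidean K X}.

Notation "''[' u , v ]" := (dotp u v) : ring_scope.

Section adjoint.
Context {K : realType} {X Y : euclideanType K}.
Implicit Types (u v x : X) (y : Y).

Lemma dotp_inj u v : (forall x, '[u, x] = '[v, x]) -> u = v.
Proof.
move=> uv; apply/eqP; rewrite -subr_eq0 -normr_eq0 -sqrf_eq0 dotp_normE.
by rewrite linearBl/= uv subrr.
Qed.

Lemma riesz (l : {linear X -> K^o}) : exists u, forall x, '[u, x] = l x.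
Proof.
pose dual u : 'Hom(X, K^o) := linfun (dotp u : X -> K^o).
have dualE u x : dual u x = '[u, x] by rewrite lfunE.
have dual_linear : linear dual.
  move=> a u v; apply/lfunP => x.
  by rewrite add_lfunE scale_lfunE !dualE linearDl/= linearZl_LR.
pose D := HB.pack_for {linear X -> 'Hom(X, K^o)} dual
  (GRing.isLinear.Build K X 'Hom(X, K^o) _ dual dual_linear).
have ker0 : lker (linfun D) == 0%VS.
  apply/lker0P => u v; rewrite !lfunE/= => uv.
  by apply: dotp_inj => x; rewrite -!dualE uv.
have /eqP im : (limg (linfun D) == fullv)%VS.
  rewrite eqEdim subvf limg_dim_eq ?(eqP ker0) ?capv0//.
  by rewrite !dimvf/= /dim/= muln1.
have : linfun l \in limg (linfun D) by rewrite im memvf.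
move=> /memv_imgP[u _ lu]; exists u => x.
by rewrite -dualE; move: lu; rewrite lfunE/= => <-; rewrite lfunE.
Qed.

(* The default value 0 is never used: such a [v] exists, by [adjointE]. *)
Definition adjoint (Phi : {linear X -> Y}) (y : Y) : X :=
  xget 0 [set v | forall x, '[v, x] = '[y, Phi x]].

Lemma adjointE (Phi : {linear X -> Y}) x y : '[adjoint Phi y, x] = '[y, Phi x].
Proof.
rewrite /adjoint; case: xgetP => [v _ ->//|] no.
pose l x : K^o := '[y, Phi x].
have lin : linear l by move=> a u v; rewrite /l !linearP.
pose L := HB.pack_for {linear X -> K^o} l (GRing.isLinear.Build K X K^o _ l lin).
by have [v vl] := riesz L; case: (no v).
Qed.

End adjoint.

Section convex_analysis.
Context {K : realType} {X : euclideanType K}.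

Definition fenchel_conjugate (f : X -> \bar K) (v : X) : \bar K :=
  ereal_sup [set ('[v, x]%:E - f x)%E | x in [set: X]].

Definition subdifferential (f : X -> \bar K) (x : X) : set X :=
  [set v | f x \is a fin_num /\
           forall z, (f x + '[v, z - x]%:E <= f z)%E].

Definition subdifferential_image (f : X -> \bar K) (S : set X) : set X :=
  \bigcup_(v in S) subdifferential f v.

(* The sequence [t] is positive and tends to 0; it need not be monotone. *)
Definition tangent_cone (Omega : set X) (x0 : X) : set X :=
  [set w | exists (t : K^nat) (w_ : X^nat),
    [/\ forall k, 0 < t k, t k @[k --> \oo] --> 0, w_ k @[k --> \oo] --> w &
        forall k, Omega (x0 + t k *: w_ k)]].

Definition sharp_minimizer (f : X -> \bar K) (x0 : X) :=
  exists c eps : K, [/\ 0 < c, 0 < eps &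
    forall x, `|x - x0| <= eps -> ((c * `|x - x0|)%:E <= f x - f x0)%E].

End convex_analysis.

Section recovery.
Context {K : realType} {X Y : euclideanType K}.
Variables (Phi : {linear X -> Y}) (R : X -> K).

Definition constrained (y0 : Y) (x : X) : \bar K :=
  if Phi x == y0 then (R x)%:E else +oo%E.

Definition sharp_solution (y0 : Y) (x0 : X) :=
  Phi x0 = y0 /\ sharp_minimizer (constrained y0) x0.

Definition regularized (y : Y) (mu : K) (x : X) : K :=
  2^-1 * `|Phi x - y| ^+ 2 + mu * R x.

Definition optimal_solution (y : Y) (mu : K) (x : X) :=
  forall z, regularized y mu x <= regularized y mu z.

Definition stable_recovery (y0 : Y) (x0 : X) :=
  forall c : K, 0 < c -> exists L dbar : K, [/\ 0 < L, 0 < dbar &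
    forall delta y x, 0 < delta < dbar -> `|y - y0| <= delta ->
      optimal_solution y (c * delta) x -> `|x - x0| <= L * delta].

End recovery.

(* Main.v *)
Require Import Defs.
From mathcomp Require Import all_boot all_order all_algebra.
From mathcomp Require Import all_classical all_reals all_analysis.
From mathcomp Require Import ring lra.
Import Order.TTheory GRing.Theory Num.Theory.
Import numFieldNormedType.Exports.
Local Open Scope classical_set_scope.
Local Open Scope ring_scope.

(** Everything follows from one global inequality: at a sharp minimizer [x0]
    there are [c, kappa > 0] such that, for all [x],
    [c * |x - x0| - kappa * |Phi x - y0| <= R x - R x0]
    ([sharp_solution_growth]). A point near [x0] can be moved into the affine
    space [Phi x = y0] at a cost proportional to [|Phi x - y0|], in distance
    because [Phi] has a bounded generalized inverse, and in the value of [R]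
    because a continuous convex function is locally Lipschitz; sharpness
    applies to the moved point. Convexity along the segment from [x0] extends
    the inequality to the whole space.

    Let [F] be the objective of the regularized problem [P(y, mu)]. Completing
    a square in the inequality turns [F x <= F x0] into an explicit bound on
    [|x - x0|] ([regularized_estimate]). With [|y - y0| <= delta] and
    [mu] proportional to [delta], this bound is linear in [delta], which is
    stable recovery. The same bound makes [F] coercive, so [P(y, mu)] has a
    solution [x]; the first order condition says that
    [Phi^* ((y - Phi x) / mu)] is a subgradient of [R] at [x]. These
    solutions replace every appeal to a separation theorem:
    - with [y = y0] and [mu] tending to 0 they are points of the set
      [dR^*(Im Phi^* )] that tend to [x0], so that 0 is a tangent vector;
    - with [Phi = id], for which every point is trivially a sharp solution,
      they give that [x] in [dR^*(v)] implies [v] in [dR(x)]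
      ([subdifferential_conjugateP]).

    Let finally [w] in [Ker Phi] be the limit of vectors [w_k] such that
    [x_k = x0 + t_k w_k] has a subgradient [v_k] in [Im Phi^*], with [t_k]
    tending to 0. As [v_k] is orthogonal to [w],
    [R x_k - R x0 <= t_k * <v_k, w_k - w>], and the [v_k] are bounded, so this
    is [o(t_k)]; since [Phi w_k] tends to 0, the growth inequality at [x_k]
    forces [c * |w| <= 0] ([tangent_cone_ker]). *)

(** * Euclidean spaces: bounded linear maps, coercive minimization *)

Section euclidean.
Context {K : realType} {X : euclideanType K}.
Implicit Types (u v x : X).

Lemma dotpC u v : '[u, v] = '[v, u].
Proof. by have /= := hermitian_subproof (s := @dotp K X) u v; rewrite expr0 mul1r. Qed.

Lemma dotpDr u v w : '[u, v + w] = '[u, v] + '[u, w] :> K.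
Proof. exact: linearD. Qed.
Lemma dotpNr u v : '[u, - v] = - '[u, v] :> K.
Proof. exact: linearN. Qed.
Lemma dotpZr a u v : '[u, a *: v] = a * '[u, v] :> K.
Proof. exact: linearZ. Qed.
Lemma dotpDl u v w : '[u + v, w] = '[u, w] + '[v, w] :> K.
Proof. by rewrite dotpC dotpDr !(dotpC w). Qed.
Lemma dotpNl u v : '[- u, v] = - '[u, v] :> K.
Proof. by rewrite dotpC dotpNr dotpC. Qed.
Lemma dotpZl a u v : '[a *: u, v] = a * '[u, v] :> K.
Proof. by rewrite dotpC dotpZr dotpC. Qed.

Definition dotpE := (dotpDl, dotpDr, dotpNl, dotpNr, dotpZl, dotpZr).

Lemma ler_dotp u v : '[u, v] <= `|u| * `|v|.
Proof.
have [->|u0] := eqVneq u 0.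
  by rewrite -(scale0r (0 : X)) dotpZl mul0r mulr_ge0.
have [->|v0] := eqVneq v 0.
  by rewrite -(scale0r (0 : X)) dotpZr mul0r mulr_ge0.
have uv0 : 0 < `|u| * `|v| by rewrite mulr_gt0 ?normr_gt0.
have : 0 <= `| `|v| *: u - `|u| *: v| ^+ 2 by rewrite exprn_ge0.
rewrite dotp_normE !dotpE -!dotp_normE (dotpC v u) => h.
have {}h : 0 <= (`|u| * `|v|) * (`|u| * `|v| - '[u, v]).
  by move: h; lra.
by move: h; rewrite pmulr_rge0 // subr_ge0.
Qed.

Lemma ler_norm_dotp u v : `|'[u, v]| <= `|u| * `|v|.
Proof. by rewrite ler_norml ler_dotp lerNl -dotpNr -(normrN v) ler_dotp. Qed.

Let e := vbasis {:X}.

(** A coordinate is a linear functional, hence an inner product with a fixed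
    vector, which the Cauchy-Schwarz inequality bounds. *)
Lemma coord_bounded :
  exists2 C : K, 0 < C & forall x i, `|coord e i x| <= C * `|x|.
Proof.
have /choice [u uP] i : exists u : X, forall x, '[u, x] = coord e i x.
  exact: (riesz (coord e i)).
exists (1 + \sum_i `|u i|) => [|x i]; first by rewrite ltr_pwDl ?sumr_ge0.
rewrite -uP (le_trans (ler_norm_dotp _ _))// ler_wpM2r//.
by rewrite (bigD1 i)//= addrCA lerDl addr_ge0// sumr_ge0.
Qed.

Lemma linear_bounded {Y : normedModType K} (f : {linear X -> Y}) :
  exists2 M : K, 0 < M & forall x, `|f x| <= M * `|x|.
Proof.
have [C C0 CP] := coord_bounded.
exists (1 + \sum_(i < \dim {:X}) C * `|f e`_i|) => [|x].
  by rewrite ltr_pwDl// sumr_ge0// => i _; rewrite mulr_ge0// ltW.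
rewrite [in leLHS](coord_vbasis (memvf x)) linear_sum (le_trans (ler_norm_sum _ _ _))//.
rewrite mulrDl mul1r ler_wpDl// mulr_suml ler_sum// => i _.
by rewrite linearZ normrZ mulrAC ler_wpM2r.
Qed.

(** Coordinates carry the sublevel set of [F] at [x0] into a closed ball of
    row vectors, which is compact; outside that set [F] exceeds [F x0]. *)
Lemma coercive_min (F : X -> K) x0 r : continuous F ->
  (forall x, F x <= F x0 -> `|x - x0| <= r) -> exists m, forall z, F m <= F z.
Proof.
move=> Fc Fr; have [C C0 CP] := coord_bounded.
pose M := C * (r + `|x0|).
pose crd : X -> 'rV[K]_(\dim {:X}) := passmx.rVof e.
pose vec : 'rV[K]_(\dim {:X}) -> X := passmx.vecof e.
have crdK : cancel crd vec by apply: passmx.rVofK; exact: vbasisP.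
have vM x : F x <= F x0 -> `|crd x| <= M.
  move=> /Fr xr; rewrite [leLHS]mx_normrE.
  apply: bigmax_le => [|[i j] _ /=].
    by rewrite mulr_ge0 ?(ltW C0)// addr_ge0// (le_trans _ xr).
  rewrite mxE (le_trans (CP _ _))// ler_pM2l//.
  by rewrite -lerBlDr (le_trans (lerB_dist _ _)).
pose A := [set c : 'rV[K]_(\dim {:X}) | `|c| <= M].
have cA : compact A.
  apply: bounded_closed_compact.
    exists M; split; first exact: num_real.
    by move=> N MN c /= /le_trans; apply; exact: ltW.
  rewrite (_ : A = Num.norm @^-1` [set a : K | a <= M])//.
  apply: preimage_closed; last exact: closed_le.
  by move=> ? _; exact: norm_continuous.
have cr : continuous vec.
  apply: continuous_big => [|i _ c]; first exact: add_continuous.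
  apply: cvgZr_tmp; [exact: (nbhs_filter c)|exact: coord_continuous].
have A0 : A (crd x0) by apply: vM.
have [||c _ cP] := @EVT_min_rV K _ (F \o vec) A _ cA.
- by exists (crd x0).
- by apply: continuous_subspaceT => c; apply: continuous_comp; [exact: cr|exact: Fc].
exists (vec c) => z; have [zx|/ltW xz] := leP (F z) (F x0).
  by have := cP (crd z); rewrite /= crdK; apply; rewrite inE; exact: vM.
by rewrite (le_trans _ xz)//; have := cP (crd x0); rewrite /= crdK; apply; rewrite inE.
Qed.

End euclidean.

(** * Continuous convex functions *)

Section convex.
Context {K : realType} {X : euclideanType K}.
Context {R : X -> K}.
Hypothesis R_continuous : continuous R.
Hypothesis R_convex : convex_function [set: convex_lmodType X] R.

Lemma convex_segment x y (s : K) : 0 <= s <= 1 ->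
  R (x + s *: (y - x)) <= R x + s * (R y - R x).
Proof.
move=> /andP[s0 s1]; have h : R (s *: y + (1 - s) *: x) <= s * R y + (1 - s) * R x.
  exact: (@R_convex (Itv01 s0 s1) y x (in_setT _) (in_setT _)).
have -> : x + s *: (y - x) = s *: y + (1 - s) *: x.
  by rewrite scalerBr scalerBl scale1r addrCA.
by rewrite (le_trans h)//; lra.
Qed.

(** Prolonging the segment from [x] to [y] by a fixed length [r] beyond [y]
    gives a point [z] where [R] is still bounded; convexity on [x, z] bounds
    the slope between [x] and [y] by (oscillation of [R]) / [r]. *)
Lemma convex_locally_lipschitz x0 : exists L r : K, [/\ 0 < L, 0 < r &
  forall x y, `|x - x0| <= r -> `|y - x0| <= r -> R y - R x <= L * `|y - x|].
Proof.
have /cvgrPdist_lt /(_ 1 ltr01) := R_continuous x0.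
rewrite near_nbhs => /nbhs_normP[rho /= rho0 near0].
have bnd z : `|z - x0| < rho -> `|R x0 - R z| < 1.
  by move=> zr; apply: near0; rewrite /= distrC.
(* Points of the ball of radius [r] stay in the ball of radius [rho] after
   being moved by [r]. *)
pose r := rho / 3.
have r0 : 0 < r by rewrite divr_gt0.
exists (2 / r), r; split => //; first by rewrite divr_gt0.
move=> x y xr yr; have [->|xy] := eqVneq y x; first by rewrite !subrr normr0 mulr0.
pose d := `|y - x|; have d0 : 0 < d by rewrite normr_gt0 subr_eq0.
pose z := y + (r / d) *: (y - x).
have zr : `|z - x0| < rho.
  rewrite /z addrAC (le_lt_trans (ler_normD _ _))//.
  rewrite normrZ (ger0_norm (ltW (divr_gt0 r0 d0))).
  rewrite divfK ?gt_eqF// (@le_lt_trans _ _ (r + r)) ?lerD2r// /r; move: rho0; lra.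
pose s := d / (d + r).
have dr0 : 0 < d + r by rewrite addr_gt0.
have s0 : 0 < s by rewrite divr_gt0.
have s1 : s <= 1 by rewrite ler_pdivrMr// mul1r lerDl ltW.
have yE : y = x + s *: (z - x).
  have -> : z - x = (1 + r / d) *: (y - x) by rewrite scalerDl scale1r addrAC.
  rewrite scalerA.
  rewrite (_ : s * (1 + r / d) = 1) ?scale1r ?subrKC//.
  by rewrite /s; field; rewrite !gt_eqF.
have : R y <= R x + s * (R z - R x) by rewrite {1}yE convex_segment// s1 ltW.
have Rzx : R z - R x <= 2.
  have xr' : `|x - x0| < rho by rewrite (le_lt_trans xr)// /r; move: rho0; lra.
  have := bnd _ zr; have := bnd _ xr'; rewrite !ltr_norml.
  by move=> /andP[? ?] /andP[? ?]; lra.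
have : s * (R z - R x) <= s * 2 by rewrite ler_pM2l.
suff : s * 2 <= 2 / r * d by rewrite -/d; lra.
rewrite (_ : s * 2 = 2 * d / (d + r)); last by rewrite /s; ring.
by rewrite [leRHS]mulrAC ler_pM2l ?mulr_gt0// lef_pV2 ?posrE// lerDr ltW.
Qed.
End convex.

(** * Sharp growth and the regularized problem *)

Section growth.
Context {K : realType} {X Y : euclideanType K}.
Context {Phi : {linear X -> Y}} {R : X -> K}.

(** The generalized inverse of [Phi], linear hence bounded, moves any [x] to
    the kernel of [Phi] at a cost proportional to [|Phi x|]. *)
Lemma linear_section_bounded : exists2 M : K, 0 < M &
  forall x, exists2 p, Phi p = Phi x & `|p| <= M * `|Phi x|.
Proof.
have [M M0 MP] := linear_bounded ((linfun Phi)^-1)%VF.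
exists M => // x; exists ((linfun Phi)^-1%VF (Phi x)); last exact: MP.
have := limg_lfunVK (memv_img (linfun Phi) (memvf x)).
by rewrite !lfunE.
Qed.

Lemma sharp_solutionP {y0 x0} : sharp_solution Phi R y0 x0 ->
  Phi x0 = y0 /\ exists c eps : K, [/\ 0 < c, 0 < eps &
    forall x, Phi x = y0 -> `|x - x0| <= eps -> c * `|x - x0| <= R x - R x0].
Proof.
move=> [Px0 [c [eps [c0 eps0 sharp]]]]; split=> //; exists c, eps; split=> // x Px.
by move=> /sharp; rewrite /constrained Px Px0 eqxx -EFinB lee_fin.
Qed.

(** Exact penalty form of sharpness: [x0] is a sharp unconstrained minimizer
    of [R] plus a multiple of the constraint violation. *)
Definition sharp_growth (Phi : {linear X -> Y}) (R : X -> K) (y0 : Y) (x0 : X) (c kappa : K) :=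
  forall x, c * `|x - x0| - kappa * `|Phi x - y0| <= R x - R x0.

(** Near [x0], a correction [p] brings [x] to the constraint set, where
    sharpness applies, while [R] varies by at most [L * |p|]. Far from [x0],
    the left-hand side is homogeneous along the ray from [x0] through [x], and
    convexity compares [x] with the point of the ray at distance [rho]. *)
Lemma sharp_solution_growth {y0 x0} : continuous R ->
  convex_function [set: convex_lmodType X] R ->
  sharp_solution Phi R y0 x0 ->
  exists c kappa : K, [/\ 0 < c, 0 < kappa & sharp_growth Phi R y0 x0 c kappa].
Proof.
move=> R_continuous R_convex /sharp_solutionP[Px0 [c [eps [c0 eps0 sharp]]]].
have [L [r [L0 r0 lip]]] := convex_locally_lipschitz R_continuous R_convex x0.
have [M M0 sect] := linear_section_bounded.
have [N N0 PhiN] := linear_bounded Phi.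
pose kappa := (L + c) * M; exists c, kappa; split=> //; first by rewrite mulr_gt0 ?addr_gt0.
pose m := Num.min r eps; have m0 : 0 < m by rewrite lt_min r0.
have MN1 : 1 <= 1 + M * N by rewrite lerDl mulr_ge0 ?ltW.
have MN0 : 0 < 1 + M * N by rewrite (lt_le_trans ltr01).
(* The corrected point satisfies [|x - p - x0| <= (1 + M * N) * |x - x0|]: on
   the ball of radius [rho] it stays within the reach of sharpness and of the
   Lipschitz bound. *)
pose rho := m / (1 + M * N); have rho0 : 0 < rho by rewrite divr_gt0.
have rhom : rho <= m by rewrite ler_pdivrMr// ler_peMr// ltW.
have growth_near x : `|x - x0| <= rho ->
    c * `|x - x0| - kappa * `|Phi (x - x0)| <= R x - R x0.
  move=> xrho; have [p Pp ple] := sect (x - x0).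
  have pN : `|p| <= M * N * `|x - x0|.
    by rewrite (le_trans ple)// -mulrA ler_pM2l.
  have x'x0 : `|x - p - x0| <= m.
    rewrite addrAC (le_trans (ler_normB _ _))// (le_trans (lerD (lexx _) pN))//.
    by rewrite -[X in X + _]mul1r -mulrDl mulrC -ler_pdivlMr.
  have := sharp (x - p); rewrite raddfB/= Pp raddfB/= subKr => /(_ Px0).
  rewrite (le_trans x'x0) ?ge_min ?lexx ?orbT// => /(_ isT) sharpp.
  have lipp : R (x - p) - R x <= L * `|p|.
    have -> : p = x - (x - p) by rewrite subKr.
    rewrite distrC subKr; apply: lip.
      by rewrite (le_trans xrho)// (le_trans rhom)// ge_min lexx.
    by rewrite (le_trans x'x0)// ge_min lexx.
  have tri : `|x - x0| - `|p| <= `|x - p - x0| by rewrite addrAC lerB_dist.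
  have : c * (`|x - x0| - `|p|) <= c * `|x - p - x0| by rewrite ler_pM2l.
  have : (L + c) * `|p| <= (L + c) * (M * `|Phi (x - x0)|) by rewrite ler_pM2l// addr_gt0.
  by rewrite mulrA -/kappa raddfB/=; lra.
move=> x; rewrite -Px0 -raddfB; have [/growth_near//|xrho] := leP `|x - x0| rho.
have d0 : 0 < `|x - x0| by rewrite (lt_trans rho0).
have [s [s0 s1 sE]] : exists s : K, [/\ 0 < s, s <= 1 & s * `|x - x0| = rho].
  exists (rho / `|x - x0|); rewrite divr_gt0// divfK ?gt_eqF// ler_pdivrMr// mul1r.
  by split=> //; exact: ltW.
have := growth_near (x0 + s *: (x - x0)).
rewrite addrAC subrr add0r [Phi (s *: _)]linearZ/= !normrZ (gtr0_norm s0) sE => /(_ (lexx _)).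
have := convex_segment R_convex x0 x s; rewrite s1 ltW// => /(_ isT).
move=> cvx gr; rewrite -(ler_pM2l s0) mulrBr (mulrCA s c) (mulrCA s kappa) sE.
by move: cvx gr; lra.
Qed.

(** With [p = |Phi x - y|], the penalty [mu * kappa * |Phi x - y0|] is at most
    [mu * kappa * (p + |y - y0|)], and the data term [p ^ 2 / 2] absorbs its
    part in [p]: [mu * kappa * p - p ^ 2 / 2 <= (mu * kappa) ^ 2 / 2]. *)
Lemma regularized_estimate {y0 x0 c kappa y mu x} :
  Phi x0 = y0 -> sharp_growth Phi R y0 x0 c kappa -> 0 < kappa -> 0 < mu ->
  regularized Phi R y mu x <= regularized Phi R y mu x0 ->
  mu * c * `|x - x0| <=
    (`|y - y0| ^+ 2 + (mu * kappa) ^+ 2) / 2 + mu * kappa * `|y - y0|.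
Proof.
move=> Px0 gr kappa0 mu0; rewrite /regularized Px0 (distrC y0) => opt.
have tri : `|Phi x - y0| <= `|Phi x - y| + `|y - y0| by exact: ler_distD.
have := ler_wpM2l (ltW mu0) (gr x).
have := ler_wpM2l (ltW (mulr_gt0 mu0 kappa0)) tri.
have := sqr_ge0 (`|Phi x - y| - mu * kappa).
by move: opt; lra.
Qed.

Lemma sharp_growth_stable {y0 x0 c kappa} : Phi x0 = y0 ->
  0 < c -> 0 < kappa -> sharp_growth Phi R y0 x0 c kappa -> stable_recovery Phi R y0 x0.
Proof.
move=> Px0 c0 kappa0 gr C C0.
exists (((1 + (C * kappa) ^+ 2) / 2 + C * kappa) / (C * c)), 1; split => //.
  by rewrite divr_gt0 ?mulr_gt0// addr_gt0 ?mulr_gt0// ltr_wpDr ?sqr_ge0.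
move=> delta y x /andP[delta0 _] ydelta /(_ x0).
move=> /(regularized_estimate Px0 gr kappa0 (mulr_gt0 C0 delta0)) est.
rewrite mulrAC ler_pdivlMr ?mulr_gt0// -(ler_pM2l delta0).
have d2 : `|y - y0| ^+ 2 <= delta ^+ 2 by rewrite lerXn2r ?nnegrE// ltW.
have := ler_wpM2l (ltW (mulr_gt0 (mulr_gt0 C0 delta0) kappa0)) ydelta.
by move: est d2; lra.
Qed.

Lemma optimal_solution_exists {y0 x0 c kappa} y {mu} : continuous R -> Phi x0 = y0 ->
  0 < c -> 0 < kappa -> sharp_growth Phi R y0 x0 c kappa -> 0 < mu ->
  exists x, optimal_solution Phi R y mu x.
Proof.
move=> R_continuous Px0 c0 kappa0 gr mu0.
have [N N0 PhiN] := linear_bounded Phi.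
have Phic : continuous Phi.
  move=> x; apply/cvgrPdist_lt => e e0; near=> z.
  rewrite -raddfB/= (le_lt_trans (PhiN _))// mulrC -ltr_pdivlMr//.
  by near: z; apply: cvgr_dist_lt => //; rewrite divr_gt0.
apply: (@coercive_min _ _ _ x0) => [x|x].
  apply: cvgD; apply: cvgM; [exact: cvg_cst| |exact: cvg_cst|exact: R_continuous].
  rewrite [X in X --> _](_ : _ = (`|Phi z - y| * `|Phi z - y|) @[z --> x]) ?expr2//.
  have cN : `|Phi z - y| @[z --> x] --> `|Phi x - y|.
    by apply: cvg_norm; apply: cvgB; [exact: Phic|exact: cvg_cst].
  exact: (cvgM cN cN).
move=> /(regularized_estimate Px0 gr kappa0 mu0).
by rewrite mulrC -ler_pdivlMr ?mulr_gt0// => /le_trans; apply.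
Unshelve. all: by end_near. Qed.

(** The choice [s = a / (a + b)] contradicts [0 < a]. *)
Lemma le0_first_order (a b : K) : 0 <= b ->
  (forall s, 0 < s <= 1 -> a <= s * b) -> a <= 0.
Proof.
move=> b0 h; rewrite leNgt; apply/negP => a0.
have ab0 : 0 < a + b by rewrite ltr_wpDr.
have /h : 0 < a / (a + b) <= 1 by rewrite divr_gt0//= ler_pdivrMr// mul1r lerDl.
rewrite mulrAC ler_pdivlMr// ler_pM2l//; lra.
Qed.

Lemma normr_scaleB (s : K) (u w : Y) :
  `|s *: w - u| ^+ 2 = `|u| ^+ 2 - 2 * s * '[u, w] + s ^+ 2 * `|w| ^+ 2.
Proof. by rewrite !dotp_normE !dotpE (dotpC w u); ring. Qed.

(** First order condition: moving from [x] towards [z] by a step [s] changes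
    the smooth part by a linear term plus [O(s ^ 2)], and [mu * R] by at most
    [s * mu * (R z - R x)] by convexity. Optimality and [s] tending to 0 give
    the inequality. *)
Lemma optimal_solution_subgradient {y mu x} : 0 < mu ->
  convex_function [set: convex_lmodType X] R ->
  optimal_solution Phi R y mu x ->
  forall z, '[adjoint Phi (mu^-1 *: (y - Phi x)), z - x] <= R z - R x.
Proof.
move=> mu0 R_convex opt z; rewrite adjointE dotpZl -(ler_pM2l mu0) mulVKf ?gt_eqF//.
rewrite -subr_le0; apply: (@le0_first_order _ (`|Phi (z - x)| ^+ 2 / 2)).
  by rewrite divr_ge0// sqr_ge0.
move=> s /andP[s0 s1]; have := opt (x + s *: (z - x)).
have shift : Phi (x + s *: (z - x)) - y = s *: Phi (z - x) - (y - Phi x).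
  by rewrite raddfD/= [Phi (s *: _)]linearZ/= opprB addrAC addrC.
rewrite /regularized shift normr_scaleB (distrC (Phi x)).
have := convex_segment R_convex x z s; rewrite s1 ltW// => /(_ isT).
move=> /(ler_wpM2l (ltW mu0)) cvx opts; rewrite -(ler_pM2l s0).
by move: cvx opts; lra.
Qed.

End growth.

(** * Conjugate duality *)

Section conjugate.
Context {K : realType} {X : euclideanType K} {R : X -> K}.

Let Rstar := fenchel_conjugate (EFin \o R).

Lemma fenchel_young v x : (('[v, x] - R x)%:E <= Rstar v)%E.
Proof. by apply: ereal_sup_ubound; exists x. Qed.

Lemma fenchel_conjugateE {v x} : (forall z, '[v, z - x] <= R z - R x) ->
  Rstar v = ('[v, x] - R x)%:E.
Proof.
move=> sub; apply/eqP; rewrite eq_le fenchel_young andbT.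
apply: ub_ereal_sup => _ [z _ <-]; rewrite /= -EFinB lee_fin.
by have := sub z; rewrite dotpDr dotpNr; lra.
Qed.

Lemma subdifferential_conjugate v x : (forall z, '[v, z - x] <= R z - R x) ->
  subdifferential Rstar v x.
Proof.
move=> /fenchel_conjugateE vE; rewrite /subdifferential /= vE; split=> // z.
apply: le_trans (fenchel_young z x); rewrite -EFinD lee_fin.
by rewrite dotpDr dotpNr !(dotpC x); lra.
Qed.

(** The only feasible point is [x]. *)
Lemma sharp_solution_id x : sharp_solution idfun R x x.
Proof.
split=> //; exists 1, 1; split=> // z _; rewrite /constrained eqxx /=.
by have [->|_] := eqVneq z x; rewrite ?leey// subrr normr0 mulr0 -EFinB subrr.
Qed.

(** This is the half of conjugate duality that usually rests on
    [R^** = R]. Here the minimizer [p] of [R u + |u - (x + v)| ^ 2 / 2]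
    satisfies [x + v - p] in [dR(p)]. Testing the hypothesis on [v] at
    [x + v - p] and the Fenchel-Young inequality at [p] gives
    [<x, x - p> <= <x - p, p>], that is [|x - p| ^ 2 <= 0]; hence [p = x], and
    the subgradient at [x] is [v] itself. *)
Lemma subdifferential_conjugateP {v x} : continuous R ->
  convex_function [set: convex_lmodType X] R ->
  subdifferential Rstar v x -> forall z, '[v, z - x] <= R z - R x.
Proof.
move=> R_continuous R_convex [vfin vsub].
have [c [kappa [c0 kappa0 gr]]] :=
  sharp_solution_growth R_continuous R_convex (sharp_solution_id x).
have [p opt] := optimal_solution_exists (x + v) R_continuous erefl c0 kappa0 gr ltr01.
have := optimal_solution_subgradient ltr01 R_convex opt.
have -> : adjoint idfun (1^-1 *: (x + v - idfun p)) = x + v - p.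
  by apply: dotp_inj => z; rewrite adjointE invr1 scale1r.
move=> sub; suff xp : x = p.
  by move: sub; rewrite -xp (addrC x) addrK.
have := vsub (x + v - p).
rewrite (fenchel_conjugateE sub) -(fineK vfin) -EFinD lee_fin.
have := fenchel_young v p; rewrite -(fineK vfin) lee_fin.
rewrite (addrAC x v) addrK => low up.
apply/eqP; rewrite -subr_eq0 -normr_eq0 -sqrf_eq0 eq_le sqr_ge0 andbT dotp_normE.
by move: low up; rewrite !dotpE (dotpC p x); lra.
Qed.

End conjugate.

(** * The tangent cone at a sharp solution *)

Section tangent.
Context {K : realType} {X Y : euclideanType K} {Phi : {linear X -> Y}} {R : X -> K}.

(** Testing a subgradient [v] at [x] in its own direction, inside a ball where
    [R] is [L]-Lipschitz, compares [s * |v| ^ 2] with [L * s * |v|]. *)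
Lemma subgradient_bounded x0 : continuous R ->
  convex_function [set: convex_lmodType X] R ->
  exists L r : K, [/\ 0 < L, 0 < r & forall x v, `|x - x0| < r ->
    (forall z, '[v, z - x] <= R z - R x) -> `|v| <= L].
Proof.
move=> R_continuous R_convex.
have [L [r [L0 r0 lip]]] := convex_locally_lipschitz R_continuous R_convex x0.
exists L, r; split=> // x v xr sub.
have [->|v0] := eqVneq v 0; first by rewrite normr0 ltW.
have nv0 : 0 < `|v| by rewrite normr_gt0.
have [s s0 sE] : exists2 s : K, 0 < s & s * `|v| = r - `|x - x0|.
  by exists ((r - `|x - x0|) / `|v|); rewrite ?divfK ?gt_eqF ?divr_gt0 ?subr_gt0.
have sv : `|s *: v| = r - `|x - x0| by rewrite normrZ gtr0_norm.
have := sub (x + s *: v); have := lip x (x + s *: v) (ltW xr).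
rewrite addrAC (le_trans (ler_normD _ _)) ?sv ?subrKC// => /(_ isT).
rewrite [x + _ - x]addrAC subrr add0r => h1 h2.
have := le_trans h2 h1; rewrite dotpZr -dotp_normE normrZ gtr0_norm// (mulrCA L).
by rewrite ler_pM2l// expr2 ler_pM2r.
Qed.

(** Combining the growth inequality and the subgradient inequality at
    [x0 + t k *: u k], then dividing by [t k], gives
    [c * |w| <= D * |u k - w|] as soon as [t k *: u k] is small. *)
Lemma tangent_cone_ker {y0 x0 c kappa w} : continuous R ->
  convex_function [set: convex_lmodType X] R ->
  Phi x0 = y0 -> 0 < c -> 0 < kappa -> sharp_growth Phi R y0 x0 c kappa ->
  Phi w = 0 ->
  tangent_cone (subdifferential_image (fenchel_conjugate (EFin \o R))
                    (range (adjoint Phi))) x0 w -> w = 0.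
Proof.
move=> R_continuous R_convex Px0 c0 kappa0 gr Pw [t [u [t0 tcvg ucvg tan]]].
have [N N0 PhiN] := linear_bounded Phi.
have [L [r [L0 r0 bnd]]] := subgradient_bounded x0 R_continuous R_convex.
pose D := c + kappa * N + L.
have D0 : 0 < D by rewrite !addr_gt0 ?mulr_gt0.
have step k : `|t k *: u k| < r -> c * `|w| <= D * `|u k - w|.
  move=> tur; have [_ [y _ <-]] := tan k.
  move=> /(subdifferential_conjugateP R_continuous R_convex) sub.
  have /bnd/(_ sub) vL : `|x0 + t k *: u k - x0| < r by rewrite addrAC subrr add0r.
  have := sub x0; rewrite opprD addNKr dotpNr dotpZr => subx0.
  have vu : '[adjoint Phi y, u k] = '[adjoint Phi y, u k - w].
    by rewrite dotpDr dotpNr [in X in _ - X]adjointE Pw -(scale0r (0 : Y)) dotpZr mul0r subr0.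
  have := gr (x0 + t k *: u k).
  rewrite -Px0 -raddfB/= addrAC subrr add0r [Phi (t k *: _)]linearZ/= !normrZ gtr0_norm// => grk.
  have {}grk : t k * (c * `|u k| - kappa * `|Phi (u k)|) <= t k * '[adjoint Phi y, u k - w].
    by rewrite -vu; lra.
  rewrite ler_pM2l// in grk.
  have vuw : '[adjoint Phi y, u k - w] <= L * `|u k - w|.
    by rewrite (le_trans (ler_dotp _ _))// ler_wpM2r.
  have Pu : `|Phi (u k)| <= N * `|u k - w|.
    by have := PhiN (u k - w); rewrite raddfB/= Pw subr0.
  have := ler_wpM2l (ltW kappa0) Pu.
  have : c * `|w| <= c * (`|u k| + `|u k - w|).
    by rewrite ler_pM2l// -lerBlDl distrC -{1}(normrN) (le_trans _ (lerB_dist _ _))// normrN.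
  by rewrite /D; lra.
apply/eqP; rewrite -normr_le0 leNgt; apply/negP => w0.
have tu0 : t k *: u k @[k --> \oo] --> (0 : X) by rewrite -(scale0r w); exact: cvgZ.
have e0 : 0 < c * `|w| / D by rewrite divr_gt0// mulr_gt0.
near \oo => k.
have /step : `|t k *: u k| < r.
  by rewrite -normrN -sub0r; near: k; apply: cvgr_dist_lt.
rewrite leNgt => /negP; apply; rewrite mulrC -ltr_pdivlMr// distrC.
by near: k; apply: cvgr_dist_lt.
Unshelve. all: by end_near. Qed.

(** A point of the closure of a set has 0 as tangent vector: points [x k] at
    distance at most [t k ^ 2] give directions of norm at most [t k]. Such
    points are solutions of [P(y0, mu)], whose distance to [x0] is at most
    [mu * kappa ^ 2 / (2 * c)]; this dictates the value of [mu]. *)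
Lemma zero_tangent {y0 x0 c kappa} : continuous R ->
  convex_function [set: convex_lmodType X] R ->
  Phi x0 = y0 -> 0 < c -> 0 < kappa -> sharp_growth Phi R y0 x0 c kappa ->
  tangent_cone (subdifferential_image (fenchel_conjugate (EFin \o R))
                    (range (adjoint Phi))) x0 0.
Proof.
move=> R_continuous R_convex Px0 c0 kappa0 gr.
pose t (k : nat) : K := k.+1%:R^-1.
have t0 k : 0 < t k by rewrite invr_gt0.
have /choice[x xP] k : exists x : X, `|x - x0| <= t k ^+ 2 /\
    subdifferential_image (fenchel_conjugate (EFin \o R)) (range (adjoint Phi)) x.
  pose mu := t k ^+ 2 * (2 * c / kappa ^+ 2).
  have mu0 : 0 < mu by rewrite mulr_gt0 ?exprn_gt0// divr_gt0 ?mulr_gt0 ?exprn_gt0.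
  have [x opt] := optimal_solution_exists y0 R_continuous Px0 c0 kappa0 gr mu0.
  exists x; split.
    have := regularized_estimate Px0 gr kappa0 mu0 (opt x0).
    rewrite subrr normr0 expr0n/= add0r mulr0 addr0 -mulrA.
    rewrite (_ : _ / 2 = mu * (c * t k ^+ 2)) ?ler_pM2l//.
    by rewrite /mu; field; rewrite gt_eqF.
  exists (adjoint Phi (mu^-1 *: (y0 - Phi x))); first by eexists.
  apply: subdifferential_conjugate.
  exact: optimal_solution_subgradient mu0 R_convex opt.
exists t, (fun k => (t k)^-1 *: (x k - x0)); split => //.
- exact: cvg_harmonic.
- apply/cvgr0Pnorm_lt => e e0; near=> k.
  rewrite normrZ gtr0_norm ?invr_gt0// mulrC ltr_pdivrMr//.
  have [xk _] := xP k; rewrite (le_lt_trans xk)// expr2 ltr_pM2r//.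
  rewrite -(gtr0_norm (t0 k)) -normrN -sub0r; near: k.
  by apply: cvgr_dist_lt => //; exact: cvg_harmonic.
- by move=> k; rewrite scalerA divff ?gt_eqF// scale1r subrKC; have [] := xP k.
Unshelve. all: by end_near. Qed.
End tangent.

Theorem corollary3p6 (K : realType) (X Y : euclideanType K)
    (Phi : {linear X -> Y}) (R : X -> K)
    (R_continuous : continuous R)
    (R_convex : convex_function [set: convex_lmodType X] R)
    (y0 : Y) (x0 : X) (x0_sharp : sharp_solution Phi R y0 x0) :
  [set x | Phi x = 0] `&`
    tangent_cone (subdifferential_image (fenchel_conjugate (EFin \o R))
                    (range (adjoint Phi))) x0 = [set 0]
  /\ stable_recovery Phi R y0 x0.
Proof.
have [Px0 _] := x0_sharp.
have [c [kappa [c0 kappa0 gr]]] := sharp_solution_growth R_continuous R_convex x0_sharp.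
split; last exact: sharp_growth_stable Px0 c0 kappa0 gr.
apply/seteqP; split => [w [Pw]|_ ->].
  exact: tangent_cone_ker R_continuous R_convex Px0 c0 kappa0 gr Pw.
split; first exact: linear0.
exact: zero_tangent R_continuous R_convex Px0 c0 kappa0 gr.
Qed.
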